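(* Let $n,m\geq 1$ and let $T_1,\ldots,T_m$ be pairwise commuting $n\times n$ complex matrices, each of which is power bounded. Then there exists an invertible $n\times n$ complex matrix $Y$ such that $YT_kY^{-1}$ is a contraction for every $1\leq k\leq m$.
   Context: The norm $\|T\|$ of an $n\times n$ complex matrix $T$ is its operator norm on the Hilbert space $\mathbb{C}^n$ (Euclidean norm). $T$ is power bounded if there is a constant $K>0$ with $\|T^p\|\leq K$ for every positive integer $p$. $T$ is a contraction if $\|T\|\leq 1$. *)

(* Defs.v *)
From HB Require Import structures.
From mathcomp Require Import all_boot all_order all_algebra.
From mathcomp Require Import all_classical all_reals.
From mathcomp Require Import complex.

Set Implicit Arguments.
Unset Strict Implicit.
Unset Printing Implicit Defensive.

Import Order.TTheory GRing.Theory Num.Theory.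
Local Open Scope classical_set_scope.
Local Open Scope ring_scope.
Local Open Scope complex_scope.

(* [Normc.normc] is the real-valued modulus; the generic norm [`|z|] on [R[i]]
   takes its values in [R[i]]. *)
Definition euclidean_norm (R : realType) (n : nat) (x : 'cV[R[i]]_n) : R :=
  Num.sqrt (\sum_i Normc.normc (x i 0) ^+ 2).

(* [sup] has a junk value on unbounded sets; [has_sup_opnorm] below shows that
   this case does not occur. *)
Definition opnorm (R : realType) (n : nat) (A : 'M[R[i]]_n) : R :=
  sup [set euclidean_norm (A *m x) | x in [set x | euclidean_norm x <= 1]].

Definition power_bounded (R : realType) (n : nat) (A : 'M[R[i]]_n) : Prop :=
  exists2 K : R, 0 < K & forall p : nat, (0 < p)%N -> opnorm (A ^+ p) <= K.

Definition contraction (R : realType) (n : nat) (A : 'M[R[i]]_n) : Prop :=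
  opnorm A <= 1.

Lemma has_sup_opnorm (R : realType) (n : nat) (A : 'M[R[i]]_n) :
  has_sup [set euclidean_norm (A *m x) | x in [set x | euclidean_norm x <= 1]].
Proof.
split.
  exists (euclidean_norm (A *m 0)), 0 => //=; rewrite /euclidean_norm.
  by rewrite big1 ?sqrtr0// => i _; rewrite mxE Normc.normc0 expr0n.
pose nc := @Normc.normc R.
have nc_ge0 z : 0 <= nc z by case: z => a b; exact: sqrtr_ge0.
exists (Num.sqrt (\sum_i (\sum_j nc (A i j)) ^+ 2)) => _ [x /= x1 <-].
have xj1 j : nc (x j 0) <= 1.
  apply: le_trans x1; rewrite -(ger0_norm (nc_ge0 _)) -sqrtr_sqr.
  rewrite ler_wsqrtr// (bigD1 j)//= lerDl.
  by apply: sumr_ge0 => i _; rewrite sqr_ge0.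
rewrite ler_wsqrtr//; apply: ler_sum => i _.
rewrite lerXn2r ?nnegrE ?nc_ge0 ?sumr_ge0// mxE.
apply: (@le_trans _ _ (\sum_j nc (A i j * x j 0))).
  elim/big_ind2: _ => [|u a v b ua vb|//]; first by rewrite Normc.normc0.
  by apply: le_trans (lerD ua vb); exact: le_normcD.
by apply: ler_sum => j _; rewrite /nc Normc.normcM ler_piMr.
Qed.

(* Main.v *)
(** Renorm by one matrix at a time. Suppose [x |-> |Y x|] is a norm, [T] is power
    bounded, and for each root [a] of the characteristic polynomial of [T],
    [r_a] is its factor prime to [X - a] and [m_a] the multiplicity of [a]. The new norm is
      [|Y' x|^2 = \sum_a \sum_(j < m_a) c_a^j |Y (T - a)^j r_a(T) x|^2],
    where [c_a = (1 - |a|)^-2]. For [|a| < 1], [T] acts on the chain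
    [u_j = Y (T - a)^j r_a(T) x] by [u_j |-> a u_j + u_(j+1)], and the weights
    [c_a^j] make this a contraction; for [|a| = 1] power boundedness forces
    [(T - a) r_a(T) = 0], so one term suffices, and for [|a| > 1] it forces
    [r_a(T) = 0]. The form is definite because the [r_a] have no common root.
    Every [S] commuting with [T] and contractive for [|Y x|] remains
    contractive for [|Y' x|], since it commutes with every [(T - a)^j r_a(T)]. *)

Require Import Defs.
From HB Require Import structures.
From mathcomp Require Import all_boot all_order all_algebra.
From mathcomp Require Import all_classical all_reals.
From mathcomp Require Import complex.
From mathcomp Require Import spectral ring lra.

Set Implicit Arguments.
Unset Strict Implicit.
Unset Printing Implicit Defensive.

Import Order.TTheory GRing.Theory Num.Theory.
Local Open Scope ring_scope.
Local Open Scope complex_scope.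

(** * The squared Euclidean norm *)

Section SquaredNorm.
Variable R : realType.
Local Notation C := R[i].
Local Notation normc := (@Normc.normc R).

Lemma normc_ge0 (z : C) : 0 <= normc z.
Proof. by case: z => a b; exact: sqrtr_ge0. Qed.

Lemma normc_real (r : R) : normc r%:C = `|r|.
Proof. by rewrite /normc /= expr0n addr0 sqrtr_sqr. Qed.

Lemma normcX (z : C) p : normc (z ^+ p) = normc z ^+ p.
Proof.
elim: p => [|p IH]; first by rewrite !expr0 Normc.normc1.
by rewrite !exprS Normc.normcM IH.
Qed.

Lemma sqr_le_normcD (z w : C) : normc (z + w) ^+ 2 <= (normc z + normc w) ^+ 2.
Proof.
by rewrite lerXn2r ?nnegrE ?addr_ge0 ?normc_ge0// le_normcD.
Qed.

Definition sqn n (x : 'cV[C]_n) : R := \sum_i normc (x i 0) ^+ 2.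

Lemma euclidean_normE n (x : 'cV[C]_n) : euclidean_norm x = Num.sqrt (sqn x).
Proof. by []. Qed.

Lemma sqn_ge0 n (x : 'cV[C]_n) : 0 <= sqn x.
Proof. by apply: sumr_ge0 => i _; exact: sqr_ge0. Qed.

Lemma sqn0 n : sqn (0 : 'cV[C]_n) = 0.
Proof. by rewrite /sqn big1// => i _; rewrite mxE Normc.normc0 expr0n. Qed.

Lemma sqn_eq0 n (x : 'cV[C]_n) : sqn x = 0 -> x = 0.
Proof.
move=> /eqP; rewrite psumr_eq0 => [/allP x0|i _]; last exact: sqr_ge0.
apply/colP => i; rewrite mxE; apply: Normc.eq0_normc.
have := x0 i; rewrite mem_index_enum sqrf_eq0 => /(_ isT) /eqP; exact.
Qed.

Lemma sqnZ n (a : C) (x : 'cV[C]_n) : sqn (a *: x) = normc a ^+ 2 * sqn x.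
Proof.
by rewrite /sqn mulr_sumr; apply: eq_bigr => i _; rewrite mxE Normc.normcM exprMn.
Qed.

Lemma sqnD n (x y : 'cV[C]_n) : sqn (x + y) <= 2 * (sqn x + sqn y).
Proof.
rewrite -big_split/= mulr_sumr; apply: ler_sum => i _; rewrite mxE.
apply: le_trans (sqr_le_normcD _ _) _; rewrite -subr_ge0.
move: (normc _) (normc _) => s t.
by rewrite [X in 0 <= X](_ : _ = (s - t) ^+ 2) ?sqr_ge0//; ring.
Qed.

(* Convexity of the square, with weights [normc a] and [1 - normc a]. *)
Lemma sqnZD n (a : C) (x y : 'cV[C]_n) : normc a < 1 ->
  sqn (a *: x + y) <= normc a * sqn x + (1 - normc a)^-1 * sqn y.
Proof.
move=> a1; rewrite /sqn !mulr_sumr -big_split/=; apply: ler_sum => i _.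
rewrite !mxE; apply: le_trans (sqr_le_normcD _ _) _; rewrite Normc.normcM.
have := normc_ge0 a; have := normc_ge0 (x i 0); have := normc_ge0 (y i 0).
move: (normc a) (normc (x i 0)) (normc (y i 0)) a1 => r s t r1 t0 s0 r0.
have e0 : 0 < 1 - r by rewrite subr_gt0.
have -> : (1 - r)^-1 * t ^+ 2 = (1 - r) * ((1 - r)^-1 * t) ^+ 2.
  by field; rewrite gt_eqF.
have {1}-> : t = (1 - r) * ((1 - r)^-1 * t) by rewrite mulVKf// gt_eqF.
move: ((1 - r)^-1 * t) => u.
rewrite -subr_ge0.
rewrite [X in 0 <= X](_ : _ = r * (1 - r) * (s - u) ^+ 2); last by ring.
by rewrite mulr_ge0 ?sqr_ge0// mulr_ge0// ltW.
Qed.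

Lemma sqn_col_mx m n (x : 'cV[C]_m) (y : 'cV[C]_n) :
  sqn (col_mx x y) = sqn x + sqn y.
Proof.
rewrite /sqn big_split_ord/=; congr (_ + _).
  by apply: eq_bigr => i _; rewrite col_mxEu.
by apply: eq_bigr => i _; rewrite col_mxEd.
Qed.

Local Open Scope sesquilinear_scope.

Lemma sqn_dot n (x : 'cV[C]_n) : (sqn x)%:C = (x ^t* *m x) 0 0.
Proof.
rewrite /sqn mxE rmorph_sum; apply: eq_bigr => i _; rewrite !mxE.
by rewrite rmorphXn/= mulrC -normCK.
Qed.

(* Gram-Schmidt on the rows of the adjoint of [Z] gives [Z = Q^* Y] with
   [Q Q^* = 1]. *)
Lemma sqn_square_factor N n (Z : 'M[C]_(N, n)) : (n <= N)%N ->
  exists Y : 'M[C]_n, forall x, sqn (Z *m x) = sqn (Y *m x).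
Proof.
move=> nN; pose Q := schmidt (Z ^t*).
have /submxP[L ZL] : (Z ^t* <= Q)%MS by exact: schmidt_sub.
have QQ : Q *m Q ^t* = 1%:M by apply/unitarymxP/schmidt_unitarymx.
have ZE : Z = Q ^t* *m L ^t* by rewrite -[Z]trmxCK ZL trmx_mul map_mxM.
have ZZ : Z ^t* *m Z = L *m L ^t*.
  by rewrite ZL {1}ZE !mulmxA -[L *m Q *m _]mulmxA QQ mulmx1.
exists (L ^t*) => x; apply: (@complexI R); rewrite !sqn_dot; congr (_ 0 0).
by rewrite !trmx_mul !map_mxM trmxCK !mulmxA -[_ *m Z]mulmxA ZZ mulmxA.
Qed.

End SquaredNorm.

Lemma unitmx_ker0 (F : fieldType) n (Y : 'M[F]_n) :
  (forall x : 'cV_n, Y *m x = 0 -> x = 0) -> Y \in unitmx.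
Proof.
move=> Yinj; rewrite -unitmx_tr -row_free_unit; apply: inj_row_free => v vY.
by apply: trmx_inj; rewrite trmx0; apply: Yinj; rewrite -[Y]trmxK -trmx_mul vY trmx0.
Qed.

(** * Positive semidefinite Hermitian forms *)

Section PositiveForms.
Variable R : realType.
Local Notation C := R[i].
Variable n : nat.

(** The square factor [Y] is the matrix of the seminorm; once the form is definite, [Y] is
    invertible and conjugates to the new norm. *)
Definition psd_form (Q : 'cV[C]_n -> R) :=
  exists Y : 'M[C]_n, forall x, Q x = sqn (Y *m x).

Lemma psd_form0 : psd_form (fun=> 0).
Proof. by exists 0 => x; rewrite mul0mx sqn0. Qed.

(** Stacking the two factors gives a tall factor of the sum, which [sqn_square_factor] makes square
    again. *)
Lemma psd_formD P Q :
  psd_form P -> psd_form Q -> psd_form (fun x => P x + Q x).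
Proof.
move=> [A PA] [B QB].
have [Y YE] := sqn_square_factor (col_mx A B) (leq_addr n n).
by exists Y => x; rewrite -YE mul_col_mx sqn_col_mx PA QB.
Qed.

Lemma psd_form_sum I (s : seq I) (Q : I -> 'cV[C]_n -> R) :
  (forall i, psd_form (Q i)) -> psd_form (fun x => \sum_(i <- s) Q i x).
Proof.
move=> Qpsd; elim: s => [|i s IH].
  by have [Y YE] := psd_form0; exists Y => x; rewrite big_nil -YE.
by have [Y YE] := psd_formD (Qpsd i) IH; exists Y => x; rewrite big_cons YE.
Qed.

Lemma psd_form_sqn (c : R) (A : 'M[C]_n) :
  0 <= c -> psd_form (fun x => c * sqn (A *m x)).
Proof.
move=> c0; exists ((Num.sqrt c)%:C *: A) => x.
by rewrite -scalemxAl sqnZ normc_real ger0_norm ?sqrtr_ge0// sqr_sqrtr.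
Qed.

End PositiveForms.

(** * Contractivity for a seminorm, and growth of powers *)

Section Contractive.
Variable R : realType.
Local Notation C := R[i].
Local Notation normc := (@Normc.normc R).

Definition contractive n (Y S : 'M[C]_n) :=
  forall x : 'cV_n, sqn (Y *m (S *m x)) <= sqn (Y *m x).

Lemma contraction_conj n (Y S : 'M[C]_n) : Y \in unitmx ->
  contractive Y S -> contraction (Y *m S *m invmx Y).
Proof.
move=> Yu YS; apply: ge_sup; first by have [] := has_sup_opnorm (Y *m S *m invmx Y).
move=> _ [x /= x1 <-]; apply: le_trans x1.
rewrite !euclidean_normE ler_wsqrtr// -!mulmxA.
by apply: le_trans (YS _) _; rewrite mulKVmx.
Qed.

Lemma sqn_le_opnorm n (A : 'M[C]_n) (x : 'cV_n) :
  sqn (A *m x) <= opnorm A ^+ 2 * sqn x.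
Proof.
have [->|x0] := eqVneq x 0; first by rewrite mulmx0 sqn0 mulr0.
have s0 : 0 < sqn x.
  by rewrite lt_def sqn_ge0 andbT; apply: contra x0 => /eqP/sqn_eq0 ->.
set r := Num.sqrt (sqn x); have r0 : 0 < r by rewrite sqrtr_gt0.
have r2 : r ^+ 2 = sqn x by rewrite sqr_sqrtr// ltW.
have : euclidean_norm (A *m (r^-1%:C *: x)) <= opnorm A.
  apply: (sup_upper_bound (has_sup_opnorm A)); exists (r^-1%:C *: x) => //=.
  rewrite euclidean_normE sqnZ normc_real real_normK ?num_real// exprVn r2.
  by rewrite mulVf ?gt_eqF// sqrtr1.
rewrite euclidean_normE -scalemxAr sqnZ normc_real real_normK ?num_real// => le.
have o0 : 0 <= opnorm A by apply: le_trans le; exact: sqrtr_ge0.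
have : Num.sqrt (r^-1 ^+ 2 * sqn (A *m x)) ^+ 2 <= opnorm A ^+ 2.
  by rewrite lerXn2r ?nnegrE ?sqrtr_ge0.
rewrite sqr_sqrtr; last exact: mulr_ge0 (sqr_ge0 _) (sqn_ge0 _).
by rewrite exprVn r2 mulrC ler_pdivrMr.
Qed.

Lemma power_bounded_sqn n (T : 'M[C]_n) : power_bounded T ->
  exists2 K : R, 0 <= K &
    forall (p : nat) (x : 'cV_n), sqn (T ^+ p *m x) <= K * sqn x.
Proof.
(* The summand 1 covers [p = 0], which [power_bounded] leaves out. *)
move=> [K K0 TK]; exists (1 + K ^+ 2); first by rewrite addr_ge0 ?sqr_ge0.
move=> [|p] x.
  by rewrite expr0 mul1mx mulrDl mul1r lerDl mulr_ge0 ?sqr_ge0 ?sqn_ge0.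
apply: le_trans (sqn_le_opnorm _ _) _; apply: ler_wpM2r; first exact: sqn_ge0.
have := TK p.+1 isT; have : 0 <= opnorm (T ^+ p.+1).
  have [[y yS] _] := has_sup_opnorm (T ^+ p.+1).
  apply: le_trans (sup_upper_bound (has_sup_opnorm _) yS).
  by case: yS => z _ <-; exact: sqrtr_ge0.
by move: (opnorm _) => o o0 oK; rewrite -[leLHS]add0r lerD// lerXn2r ?nnegrE// ltW.
Qed.

Lemma bernoulli (a : R) p : 1 <= a -> 1 + (a - 1) *+ p <= a ^+ p.
Proof.
move=> a1; elim: p => [|p IH]; first by rewrite mulr0n addr0.
rewrite exprS mulrS; apply: le_trans (ler_wpM2l (le_trans ler01 a1) IH).
have : 0 <= (a - 1) * ((a - 1) *+ p) by rewrite mulr_ge0 ?mulrn_wge0 ?subr_ge0.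
by move: (_ *+ p) => y; nra.
Qed.

Lemma linear_growth_unbounded (c K : R) : 0 <= K -> 0 <= c ->
  (forall p : nat, c *+ p <= K) -> c = 0.
Proof.
move=> K0 c0 cK; apply/eqP; rewrite eq_le c0 andbT leNgt; apply/negP => cgt0.
have := archi_boundP (divr_ge0 K0 c0); rewrite ltr_pdivrMr// ltNge.
by rewrite mulr_natl cK.
Qed.

(** * Roots of modulus at least 1 *)

Section PeripheralRoots.
Variables (n : nat) (T : 'M[C]_n) (K : R).
Hypothesis K0 : 0 <= K.
Hypothesis TK : forall (p : nat) (x : 'cV_n), sqn (T ^+ p *m x) <= K * sqn x.

(** By Bernoulli, [|T^p w|^2 = |a|^(2p) |w|^2] grows at least linearly in [p], against the bound by
    [K]. *)
Lemma eigenvector_expansive (a : C) (w : 'cV_n) :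
  1 < normc a -> T *m w = a *: w -> w = 0.
Proof.
move=> a1 Tw; have Tpw p : T ^+ p *m w = a ^+ p *: w.
  elim: p => [|p IH]; first by rewrite !expr0 mul1mx scale1r.
  by rewrite exprS -mulmxA IH -scalemxAr Tw scalerA -exprSr.
have a21 : 1 < normc a ^+ 2 by rewrite expr_gt1// normc_ge0.
have := @linear_growth_unbounded ((normc a ^+ 2 - 1) * sqn w) (K * sqn w).
rewrite !mulr_ge0 ?sqn_ge0 ?subr_ge0 ?(ltW a21)// => /(_ isT isT) h.
have /eqP : (normc a ^+ 2 - 1) * sqn w = 0.
  apply: h => p; apply: le_trans (TK p w).
  rewrite Tpw sqnZ normcX -exprM mulnC exprM -mulrnAl.
  apply: ler_wpM2r; first exact: sqn_ge0.
  by apply: le_trans (bernoulli p (ltW a21)); rewrite lerDr.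
by rewrite mulf_eq0 subr_eq0 gt_eqF//= => /eqP/sqn_eq0.
Qed.

(** For [|a| = 1], [T^p z = a^p z + p a^(p-1) w], and the last term is unbounded in [p] unless
    [w = 0]. *)
Lemma peripheral_semisimple (a : C) (z w : 'cV_n) : 1 <= normc a ->
  T *m z = a *: z + w -> T *m w = a *: w -> w = 0.
Proof.
rewrite le_eqVlt => /orP[/eqP a1 Tz Tw|a1 _]; last exact: eigenvector_expansive.
have Tpz p : T ^+ p.+1 *m z = a ^+ p.+1 *: z + (p.+1%:R * a ^+ p) *: w.
  elim: p => [|p IH]; first by rewrite !expr1 expr0 mulr1 scale1r.
  rewrite exprS -mulmxA IH mulmxDr -!scalemxAr Tz Tw scalerDr !scalerA -addrA.
  rewrite -scalerDl -exprSr; congr (_ + _ *: _).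
  by rewrite [p.+2%:R]mulrS -mulrA -exprSr; ring.
apply: sqn_eq0; apply: (@linear_growth_unbounded _ (2 * (K * sqn z + sqn z))).
- by rewrite mulr_ge0 ?addr_ge0 ?mulr_ge0 ?sqn_ge0.
- exact: sqn_ge0.
case=> [|p]; first by rewrite mulr0n mulr_ge0 ?addr_ge0 ?mulr_ge0 ?sqn_ge0.
have nap q : normc (a ^+ q) ^+ 2 = 1 by rewrite normcX -a1 !expr1n.
apply: (@le_trans _ _ (sqn ((p.+1%:R * a ^+ p) *: w))).
  rewrite sqnZ Normc.normcM exprMn nap mulr1.
  have -> : p.+1%:R = (p.+1%:R : R)%:C by rewrite rmorph_nat.
  rewrite normc_real normr_nat -[leLHS]mulr_natl ler_wpM2r ?sqn_ge0//.
  (* Quadratic growth is weakened to linear growth by [p + 1 <= (p + 1)^2]. *)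
  by rewrite -natrX ler_nat expnS leq_pmulr// expn1.
rewrite [X in sqn X](_ : _ = T ^+ p.+1 *m z + (- a ^+ p.+1) *: z); last first.
  by rewrite Tpz scaleNr addrC addKr.
apply: le_trans (sqnD _ _) _; rewrite sqnZ normcN nap mul1r.
by rewrite ler_wpM2l// lerD2r.
Qed.

(** Such [a] has no Jordan block of size 2: the induction hypothesis applied to [w = (T - a) z]
    gives [T w = a w], while [T z = a z + w]. *)
Lemma peripheral_ker (a : C) k (z : 'cV_n) : 1 <= normc a ->
  (T - a%:M) ^+ k *m z = 0 -> (T - a%:M) *m z = 0.
Proof.
move=> a1; elim: k z => [|k IH] z; first by rewrite expr0 mul1mx => ->; rewrite mulmx0.
rewrite exprSr -mulmxA => /IH; set w := _ *m z => Nw.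
apply: (peripheral_semisimple (z := z) a1).
  by rewrite /w mulmxBl mul_scalar_mx addrC subrK.
by apply/eqP; rewrite -subr_eq0 -mul_scalar_mx -mulmxBl; exact/eqP.
Qed.

End PeripheralRoots.

(** Put [e = 1 - |a|] and let [S] be the right-hand side. Since [e^-1 = e * e^-2], [sqnZD] bounds
    the [j]-th term by [|a|] times the [j]-th term of [S] plus [e] times the next one; the sum is at
    most [|a| S + e S = S]. *)
Lemma chain_contractive N (a : C) m (u : nat -> 'cV[C]_N) :
  normc a < 1 -> u m = 0 ->
  \sum_(j < m) (1 - normc a) ^- 2 ^+ j * sqn (a *: u j + u j.+1) <=
  \sum_(j < m) (1 - normc a) ^- 2 ^+ j * sqn (u j).
Proof.
move=> a1 um; set e := 1 - normc a; have e0 : 0 < e by rewrite subr_gt0.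
set S := leRHS.
(* The shift adds the term [j = m], zero by [um], and drops the nonnegative term [j = 0]. *)
have shift : \sum_(j < m) e ^- 2 ^+ j.+1 * sqn (u j.+1) <= S.
  have : \sum_(j < m.+1) e ^- 2 ^+ j * sqn (u j) = S.
    by rewrite big_ord_recr/= um sqn0 mulr0 addr0.
  by rewrite big_ord_recl/= => <-; rewrite lerDr mulr_ge0 ?sqn_ge0.
apply: (@le_trans _ _ (normc a * S + e * S)); last first.
  by rewrite -mulrDl /e addrC subrK mul1r.
apply: le_trans (lerD (lexx _) (ler_wpM2l (ltW e0) shift)).
rewrite !mulr_sumr -big_split/=; apply: ler_sum => j _.
have c0 : 0 <= e ^- 2 ^+ j by rewrite exprn_ge0// invr_ge0 sqr_ge0.
apply: le_trans (ler_wpM2l c0 (sqnZD _ _ a1)) _; rewrite -/e.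
rewrite mulrDr [_ ^+ j.+1]exprS le_eqVlt; apply/orP; left; apply/eqP.
by move: (e ^- 2 ^+ j) (normc a) => c r; field; rewrite gt_eqF.
Qed.

End Contractive.

(** * Kernels of polynomials in a matrix *)

Section HornerMx.
Variables (F : closedFieldType) (n : nat) (T : 'M[F]_n.+1).

Lemma horner_mx_gcdp_ker p q (x : 'cV_n.+1) :
  horner_mx T p *m x = 0 -> horner_mx T q *m x = 0 ->
  horner_mx T (gcdp p q) *m x = 0.
Proof.
move=> px qx; have [[u v] /= /eqpP[[a b] /= /andP[a0 b0] ab]] := Bezoutp p q.
have : horner_mx T (a *: (u * p + v * q)) *m x = 0.
  rewrite -mul_polyC !rmorphM/= rmorphD/= !rmorphM/= -!mulmxE -mulmxA mulmxDl.
  by rewrite -!mulmxA px qx !mulmx0 addr0 mulmx0.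
rewrite ab -mul_polyC rmorphM/= horner_mx_C -mulmxE -mulmxA mul_scalar_mx.
by move/eqP; rewrite scaler_eq0 (negPf b0)/= => /eqP.
Qed.

(** The gcd of [ps] also kills [x]; having no root in a closed field, it is a nonzero constant. *)
Lemma coprime_annihilators (ps : seq {poly F}) (x : 'cV_n.+1) :
  (forall p, p \in ps -> horner_mx T p *m x = 0) ->
  (forall a, exists2 p, p \in ps & ~~ root p a) -> x = 0.
Proof.
move=> psx nroot; pose g := \big[gcdp (R := F)/0]_(p <- ps) p.
have gx : horner_mx T g *m x = 0.
  rewrite /g big_seq_cond; elim/big_ind: _ => [|p q|p /andP[/psx]//].
    by rewrite rmorph0 mul0mx.
  exact: horner_mx_gcdp_ker.
have /eqP/size_poly1P[c c0 gc] : size g = 1%N.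
  apply/eqP/negPn/negP => /closed_rootP[a]; rewrite root_biggcd => /allP ra.
  by have [p /ra pa /negP] := nroot a.
move: gx; rewrite gc horner_mx_C mul_scalar_mx => /eqP.
by rewrite scaler_eq0 (negPf c0)/= => /eqP.
Qed.

End HornerMx.

(** * Renorming for one more matrix *)

Section Renorming.
Variable R : realType.
Local Notation C := R[i].
Local Notation normc := (@Normc.normc R).
Variables (n : nat) (T : 'M[C]_n.+1).
Hypothesis Tpb : power_bounded T.

Lemma renorm_contractive (Y : 'M[C]_n.+1) : Y \in unitmx ->
  exists2 Y' : 'M[C]_n.+1, Y' \in unitmx &
    contractive Y' T /\
    forall S, comm_mx S T -> contractive Y S -> contractive Y' S.
Proof.
move=> Yu; have [K K0 TK] := power_bounded_sqn Tpb.
have [rs] := closed_field_poly_normal (char_poly T).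
rewrite (monicP (char_poly_monic T)) scale1r => rsE.
(* Provides a cofactor that does not vanish at points outside [rs]. *)
have rs0 : exists b, b \in rs.
  have := size_char_poly T; rewrite rsE size_prod_XsubC.
  by case: (rs) => // b s _; exists b; rewrite inE eqxx.
(* This is [r_a]. As [rs] repeats multiple roots, so do the sums over [rs]; all estimates are made
   root by root. *)
pose cof a : {poly C} := \prod_(b <- rs | b != a) ('X - b%:P).
pose mult a := if normc a < 1 then count_mem a rs else 1%N.
(* For [|a| = 1] this is the default value 0, but then [mult a = 1] and only [c a ^+ 0 = 1]
   occurs. *)
pose c a := (1 - normc a) ^- 2.
pose A a j := horner_mx T (('X - a%:P) ^+ j * cof a).
have A0 a (x : 'cV_n.+1) : a \in rs -> A a (mult a) *m x = 0.
  (* The product [(X - a)^(count_mem a rs) * cof a] is the characteristic polynomial. *)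
  have Acount : A a (count_mem a rs) = 0.
    rewrite -(Cayley_Hamilton T) rsE (bigID (pred1 a))/= /A.
    rewrite [in RHS](eq_bigr (fun=> 'X - a%:P)); last by move=> b /eqP->.
    by rewrite big_const_seq iter_mulr_1.
  rewrite /mult; case: ltP => [_ _|a1 _]; first by rewrite Acount mul0mx.
  have AE j : A a j = (T - a%:M) ^+ j *m horner_mx T (cof a).
    by rewrite /A rmorphM rmorphXn rmorphB/= horner_mx_X horner_mx_C.
  rewrite AE expr1 -mulmxA.
  apply: (peripheral_ker K0 TK (k := count_mem a rs) a1).
  by rewrite mulmxA -AE Acount mul0mx.
(* Write [X = a + (X - a)]. *)
have AT a j : A a j *m T = a *: A a j + A a j.+1.
  rewrite -[X in _ *m X](horner_mx_X T) mulmxE -rmorphM -mul_scalar_mx mulmxE.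
  rewrite -(horner_mx_C T) -rmorphM -rmorphD /=; congr horner_mx.
  by rewrite exprS; ring.
have AS a j S : comm_mx S T -> A a j *m S = S *m A a j.
  by move=> ST; apply: comm_horner_mx; exact: comm_mx_sym.
pose Q a (x : 'cV[C]_n.+1) :=
  \sum_(j < mult a) c a ^+ j * sqn (Y *m A a j *m x).
have c0 a j : 0 <= c a ^+ j by rewrite exprn_ge0// invr_ge0 sqr_ge0.
have [Y' Y'E] : psd_form (fun x => \sum_(a <- rs) Q a x).
  by apply: psd_form_sum => a; apply: psd_form_sum => j; exact: psd_form_sqn.
have Q0 a x : 0 <= Q a x.
  by apply: sumr_ge0 => j _; rewrite mulr_ge0 ?sqn_ge0.
exists Y'.
  apply: unitmx_ker0 => x Y'x.
  have := Y'E x; rewrite Y'x sqn0 => /eqP.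
  rewrite psumr_eq0// => /allP Qx.
  apply: (@coprime_annihilators _ _ T [seq cof a | a <- rs]).
    move=> _ /mapP[a ars ->]; have := Qx a ars.
    rewrite /Q psumr_eq0 => [/allP/=|j _]; last by rewrite mulr_ge0 ?sqn_ge0.
    (* The term [j = 0] is always present, with weight 1; its vanishing gives [cof a] of [T] killing
       [x], as [Y] is invertible. *)
    have m0 : (0 < mult a)%N.
      by rewrite /mult; case: ifP => // _; rewrite -has_count has_pred1.
    move=> /(_ (Ordinal m0)); rewrite mem_index_enum expr0 mul1r => /(_ isT).
    move=> /eqP/sqn_eq0 YAx; rewrite -[LHS](mulKmx Yu) -[RHS](mulmx0 _ (invmx Y)).
    by rewrite -YAx /A expr0 mul1r !mulmxA.
  move=> b; have [brs|brs] := boolP (b \in rs).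
    exists (cof b); first exact: map_f.
    by rewrite /cof -big_filter root_prod_XsubC mem_filter eqxx.
  have [a ars] := rs0; exists (cof a); first exact: map_f.
  by rewrite /cof -big_filter root_prod_XsubC mem_filter (negPf brs) andbF.
split=> [x|S ST YS x]; rewrite -!Y'E !big_seq; apply: ler_sum => a ars.
  have YAT j : Y *m A a j *m (T *m x) =
      a *: (Y *m A a j *m x) + Y *m A a j.+1 *m x.
    by rewrite mulmxA -[Y *m _ *m T]mulmxA AT mulmxDr mulmxDl -scalemxAr -scalemxAl.
  have um : Y *m A a (mult a) *m x = 0 by rewrite -mulmxA A0// mulmx0.
  have [a1|a1] := boolP (normc a < 1).
    rewrite /Q; under eq_bigr do rewrite YAT.
    exact: (chain_contractive (u := fun j => Y *m A a j *m x)).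
  (* Here the chain has one term and [T] multiplies it by [a]: an isometry if [|a| = 1], and the
     term is zero if [|a| > 1]. *)
  rewrite /Q /mult (negPf a1) !big_ord1 !expr0 !mul1r YAT.
  move: um; rewrite /mult (negPf a1) => um; rewrite um addr0.
  move: a1; rewrite -leNgt le_eqVlt => /predU1P[na|a1].
    by rewrite sqnZ -na expr1n mul1r.
  have T0 : T *m (A a 0 *m x) = a *: (A a 0 *m x).
    rewrite mulmxA -AS// AT mulmxDl -scalemxAl.
    by rewrite (_ : A a 1 *m x = 0) ?addr0//; have := A0 a x ars; rewrite /mult (lt_gtF a1).
  by rewrite -!mulmxA (eigenvector_expansive K0 TK a1 T0) !mulmx0 scaler0.
apply: ler_sum => j _; apply: ler_wpM2l => //.
(* Moving [S] to the left of [A a j] leaves contractivity for [Y] at the vector [A a j *m x]. *)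
by rewrite -!mulmxA [A a j *m _]mulmxA AS// -mulmxA; exact: YS.
Qed.

End Renorming.

Theorem theorem1p2 (R : realType) (n m : nat) (hn : (1 <= n)%N) (hm : (1 <= m)%N)
    (T : 'I_m -> 'M[R[i]]_n)
    (hcomm : forall k l : 'I_m, T k *m T l = T l *m T k)
    (hpb : forall k : 'I_m, power_bounded (T k)) :
  exists2 Y : 'M[R[i]]_n, Y \in unitmx &
    forall k : 'I_m, contraction (Y *m T k *m invmx Y).
Proof.
case: n hn T hcomm hpb => // n _ T hcomm hpb.
suff [Y Yu YT] : exists2 Y : 'M[R[i]]_n.+1, Y \in unitmx &
    forall k, k \in enum 'I_m -> contractive Y (T k).
  by exists Y => // k; apply: contraction_conj => //; apply: YT; rewrite mem_enum.
(* Start from the Euclidean norm and renorm for one [T k] at a time; those already treated commute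
   with [T k] and stay contractive. *)
elim: (enum 'I_m) => [|k s [Y Yu YT]].
  by exists 1%:M; [exact: unitmx1 | move=> k; rewrite in_nil].
have [Y' Y'u [Y'T Y'S]] := renorm_contractive (hpb k) Yu.
exists Y' => // l; rewrite inE => /predU1P[->//|/YT].
by apply: Y'S; exact: hcomm.
Qed.
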